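(* Let $f:\mathbb{R}^n\to\mathbb{R}$ be a polynomial of degree $d\geq 2$, and let $K\subset\mathbb{R}^n$ be a nonempty convex set given by $$K=\{x\in\mathbb{R}^n: p_i(x)=0,\ i=1,\dots,l,\ \ q_j(x)\leq 0,\ j=1,\dots,m\},$$ where all $p_i,q_j$ are polynomials. Assume that $\mathrm{OP}(K,f)$ is regular. If $\mathrm{Sol}(K,f)$ is nonempty, then the map $\mathrm{Sol}_K(\cdot)$, $g\mapsto\mathrm{Sol}(K,g)$, is locally upper-Hölder stable at $f$, i.e., there exist $\ell>0$, $H>0$ and $\varepsilon>0$ such that $$\mathrm{Sol}(K,g)\subset\mathrm{Sol}(K,f)+\ell\|g-f\|^{H}\,\mathbb{B}$$ for all $g\in\mathbb{R}_d[x]$ satisfying $\|g-f\|<\varepsilon$, where $\mathbb{B}$ is the closed unit ball in $\mathbb{R}^n$.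
   Context: $\mathrm{OP}(K,f)$ denotes the problem of minimizing $f(x)$ subject to $x\in K$, and $\mathrm{Sol}(K,f)$ denotes its set of (global) minimizers; $\mathrm{Sol}(S,g)$ has the same meaning for any closed set $S$ and polynomial $g$. The asymptotic cone of a nonempty closed set $S\subset\mathbb{R}^n$ is $S_\infty=\{v\in\mathbb{R}^n:\exists t_k\to+\infty,\ \exists x_k\in S \text{ with } \lim_{k\to\infty} x_k/t_k=v\}$. $f_d$ denotes the homogeneous component of degree $d$ of $f$, where $d=\deg f$. The problem $\mathrm{OP}(K,f)$ is called regular if $\mathrm{Sol}(K_\infty,f_d)$ is bounded (the empty set counts as bounded). $\mathbb{R}_d[x]$ is the space of all real polynomials in $n$ variables of degree at most $d$, with norm $\|g\|$ equal to the $\ell_2$-norm of the coefficient vector of $g$ in the monomial basis. *)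

(* Defs.v *)
From HB Require Import structures.
From mathcomp Require Import all_boot all_order all_algebra.
(* The notations of mpoly clash with those of MathComp-Analysis. *)
From mathcomp Require Import -(notations) mpoly.
From mathcomp Require Import all_classical all_reals all_analysis.

Set Implicit Arguments.
Unset Strict Implicit.
Unset Printing Implicit Defensive.

Import Order.TTheory GRing.Theory Num.Theory.
Import numFieldNormedType.Exports.

Local Open Scope classical_set_scope.
Local Open Scope ring_scope.

Section PolynomialOptimization.
Variables (R : realType) (n : nat).
Local Notation poly_n := (mpoly n R).
Implicit Types (f g : poly_n) (S K : set 'rV[R]_n) (x v : 'rV[R]_n).

Definition peval f x : R := meval (x 0) f.

(* With this truncation the zero polynomial has degree 0, so [pdeg g <= d]
   means that [g] belongs to the space of polynomials of degree at most [d],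
   zero included. *)
Definition pdeg f : nat := (mmeasure mdeg f).-1.

Definition leading_form f : poly_n :=
  pihomog mdeg (pdeg f) f.

Definition coef_norm f : R :=
  Num.sqrt (\sum_(m <- msupp f) mcoeff m f ^+ 2).

(* The library norm on ['rV[R]_n] is the sup norm, hence this definition. *)
Definition enorm x : R := Num.sqrt (\sum_i x 0 i ^+ 2).

Definition eball : set 'rV[R]_n := [set x | enorm x <= 1].

Definition Sol S f : set 'rV[R]_n :=
  [set x | S x /\ forall y, S y -> peval f x <= peval f y].

Definition asymptotic_cone S : set 'rV[R]_n :=
  [set v | exists (t : nat -> R) (x : nat -> 'rV[R]_n),
    [/\ t @ \oo --> +oo, forall k, S (x k)
      & (fun k => (t k)^-1 *: x k) @ \oo --> v]].

(* Boundedness is in the sup norm, which is equivalent to the Euclidean one. *)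
Definition regular K f : Prop :=
  bounded_set (Sol (asymptotic_cone K) (leading_form f)).

End PolynomialOptimization.

(* Main.v *)
Require Import Defs.
From mathcomp Require Import all_boot all_order all_algebra.
From mathcomp Require Import -(notations) mpoly.
From mathcomp Require Import all_classical all_reals all_analysis.
From mathcomp Require ordered_qelim qe_rcf polyrcf.
From mathcomp Require Import ring lra.

Set Implicit Arguments.
Unset Strict Implicit.
Unset Printing Implicit Defensive.

Import Order.TTheory GRing.Theory Num.Theory.
Import numFieldNormedType.Exports.

Local Open Scope classical_set_scope.
Local Open Scope ring_scope.

(** Let [w] be the minimum of [f] on [K]. The proof combines a uniform bound on
    the perturbed minimizers with a Lojasiewicz-type error bound.

    Boundedness. As [f] is bounded below on [K], its leading form is nonnegative
    on the asymptotic cone, and by homogeneity regularity forces it to be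
    positive there outside 0 ([leading_form_gt0_cone]). By compactness of the
    unit sphere the leading form dominates a multiple of [`|x| ^ d] on the far
    part of [K] ([leading_form_coercive]), so for all [g] close to [f] the
    minimizers of [g] lie in one common ball ([Sol_locally_bounded]). There, a
    minimizer [x] of [g] satisfies [f x <= w + t] with [t] proportional to
    [coef_norm (g - f)] ([Sol_perturbation_value]).

    Error bound. It remains to bound the distance from such an [x] to
    [Sol K f] by a power of [t] ([sublevel_holder_bound]). Consider the relation
    D t r: some point of [K] in the ball with [f <= w + t] is at squared
    distance at least [r] from [Sol K f] ([sublevel_gap]). It is first-order
    definable over the reals, so quantifier elimination provides a single
    nonzero polynomial in two variables such that, for each [t > 0], the supremum
    phi t of the slice at [t] is one of its zeros ([holds_locally_constant]). By
    compactness phi t tends to 0 with [t] ([sublevel_gap_vanishes]), and a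
    nonzero polynomial vanishing at (t, phi t) with phi t small forces
    [phi t ^ k.+1 <= C * t] ([zero_set_power_bound],
    [definable_vanishing_rate]). *)

(** * Plane sets definable over a real closed field *)

Section LocalConstancy.
Import ordered_qelim.ord.
Variable R : rcfType.

(** The outer indeterminate stands for variable 0 and the coefficients are
    polynomials in variable 1: fixing variable 0 at [t] is then the single
    evaluation at [t%:P]. Inverses are sent to 0 because they are excluded by
    [rterm]. *)
Fixpoint bipoly_of_term (u : GRing.term R) : {poly {poly R}} :=
  match u with
  | GRing.Var 0 => 'X
  | GRing.Var 1 => 'X%:P
  | GRing.Var _ => 0
  | GRing.Const c => c%:P%:P
  | GRing.NatConst k => k%:R
  | GRing.Add u1 u2 => bipoly_of_term u1 + bipoly_of_term u2
  | GRing.Opp u1 => - bipoly_of_term u1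
  | GRing.NatMul u1 k => bipoly_of_term u1 *+ k
  | GRing.Mul u1 u2 => bipoly_of_term u1 * bipoly_of_term u2
  | GRing.Inv _ => 0
  | GRing.Exp u1 k => bipoly_of_term u1 ^+ k
  end.

Lemma eval_bipoly_of_term (u : GRing.term R) (t s : R) :
  GRing.rterm u ->
  GRing.eval [:: t; s] u = (bipoly_of_term u).[t%:P].[s].
Proof.
elim: u => //=.
- by case=> [|[|i]] _ /=; rewrite ?hornerX ?hornerC ?hornerX ?nth_nil ?horner0.
- by move=> c _; rewrite !hornerC.
- by move=> k _; rewrite !hornerMn -!polyC1 !hornerC.
- by move=> u1 IH1 u2 IH2 /andP[/IH1-> /IH2->]; rewrite !hornerD.
- by move=> u1 IH1 /IH1->; rewrite !hornerN.
- by move=> u1 IH1 k /IH1->; rewrite !hornerMn.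
- by move=> u1 IH1 u2 IH2 /andP[/IH1-> /IH2->]; rewrite !hornerM.
- by move=> u1 IH1 k /IH1->; rewrite !horner_exp.
Qed.

Lemma horner_sgr_locally_constant (p : {poly R}) (x : R) : p.[x] != 0 ->
  exists2 delta : R, 0 < delta &
    forall y, `|y - x| < delta -> Num.sg p.[y] = Num.sg p.[x].
Proof.
move=> px0; have npx : 0 < `|p.[x]| by rewrite normr_gt0.
have [delta d0 hd] := @polyrcf.poly_cont R x p _ npx.
exists delta => // y /hd; rewrite ltr_distl => /andP[].
have [px|px|px] := ltrgt0P p.[x]; last by rewrite px eqxx in px0.
  by rewrite subrr => py _; rewrite !gtr0_sg.
by rewrite addrN => _ py; rewrite !ltr0_sg.
Qed.

(** An atom whose two sides coincide as polynomials has a constant truth value,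
    so [p] can be taken to be 1; otherwise [p] is the difference of the two
    sides, whose sign cannot change near a point where it does not vanish. *)
Lemma atom_locally_constant (test : R -> R -> bool) (u1 u2 : GRing.term R) :
  (forall a b c d, Num.sg (a - b) = Num.sg (c - d) -> test a b = test c d) ->
  GRing.rterm u1 && GRing.rterm u2 ->
  exists2 p : {poly {poly R}}, p != 0 &
    forall t s0, p.[t%:P].[s0] != 0 ->
      exists2 delta : R, 0 < delta & forall s : R, `|s - s0| < delta ->
        test (GRing.eval [:: t; s] u1) (GRing.eval [:: t; s] u2)
        = test (GRing.eval [:: t; s0] u1) (GRing.eval [:: t; s0] u2).
Proof.
move=> test_sg /andP[r1 r2].
pose D := bipoly_of_term u1 - bipoly_of_term u2.
have evD t s : GRing.eval [:: t; s] u1 - GRing.eval [:: t; s] u2 = D.[t%:P].[s].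
  by rewrite !eval_bipoly_of_term // /D hornerD hornerN hornerD hornerN.
have [D0|D0] := eqVneq D 0.
  exists 1; first exact: oner_neq0.
  by move=> t s0 _; exists 1 => // s _; apply: test_sg; rewrite !evD D0 !horner0.
exists D => // t s0 /horner_sgr_locally_constant[delta d0 hdelta].
by exists delta => // s /hdelta sgE; apply: test_sg; rewrite !evD.
Qed.

(** The product of the polynomials attached to the atoms controls all of them
    at once. *)
Lemma qf_locally_constant (F : formula R) : qf_form F -> rformula F ->
  exists2 p : {poly {poly R}}, p != 0 &
    forall t s0, p.[t%:P].[s0] != 0 ->
      exists2 delta : R, 0 < delta & forall s : R, `|s - s0| < delta ->
        qf_eval [:: t; s] F = qf_eval [:: t; s0] F.
Proof.
have binary (op : bool -> bool -> bool) (F1 F2 : formula R) :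
    (exists2 p : {poly {poly R}}, p != 0 &
      forall t s0, p.[t%:P].[s0] != 0 ->
        exists2 delta : R, 0 < delta & forall s : R, `|s - s0| < delta ->
          qf_eval [:: t; s] F1 = qf_eval [:: t; s0] F1) ->
    (exists2 p : {poly {poly R}}, p != 0 &
      forall t s0, p.[t%:P].[s0] != 0 ->
        exists2 delta : R, 0 < delta & forall s : R, `|s - s0| < delta ->
          qf_eval [:: t; s] F2 = qf_eval [:: t; s0] F2) ->
    exists2 p : {poly {poly R}}, p != 0 &
      forall t s0, p.[t%:P].[s0] != 0 ->
        exists2 delta : R, 0 < delta & forall s : R, `|s - s0| < delta ->
          op (qf_eval [:: t; s] F1) (qf_eval [:: t; s] F2)
          = op (qf_eval [:: t; s0] F1) (qf_eval [:: t; s0] F2).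
  move=> [p1 p1_n0 h1] [p2 p2_n0 h2]; exists (p1 * p2); first by rewrite mulf_neq0.
  move=> t s0; rewrite !hornerM mulf_eq0 negb_or => /andP[/h1[d1 d1_gt0 {}h1]].
  move=> /h2[d2 d2_gt0 {}h2]; exists (Num.min d1 d2); first by rewrite lt_min d1_gt0.
  by move=> s; rewrite lt_min => /andP[/h1-> /h2->].
elim: F => //=.
- move=> b _ _; exists 1; first exact: oner_neq0.
  by move=> t s0 _; exists 1.
- move=> u1 u2 _; apply: (atom_locally_constant (test := fun a b => a == b)).
  by move=> a b c d E; rewrite -subr_eq0 -sgr_eq0 E sgr_eq0 subr_eq0.
- move=> u1 u2 _; apply: (atom_locally_constant (test := fun a b => a < b)).
  by move=> a b c d E; rewrite -subr_lt0 -sgr_lt0 E sgr_lt0 subr_lt0.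
- move=> u1 u2 _; apply: (atom_locally_constant (test := fun a b => a <= b)).
  by move=> a b c d E; rewrite -subr_le0 -sgr_le0 E sgr_le0 subr_le0.
- move=> F1 IH1 F2 IH2 /andP[q1 q2] /andP[r1 r2].
  exact: (binary andb _ _ (IH1 q1 r1) (IH2 q2 r2)).
- move=> F1 IH1 F2 IH2 /andP[q1 q2] /andP[r1 r2].
  exact: (binary orb _ _ (IH1 q1 r1) (IH2 q2 r2)).
- move=> F1 IH1 F2 IH2 /andP[q1 q2] /andP[r1 r2].
  exact: (binary implb _ _ (IH1 q1 r1) (IH2 q2 r2)).
- move=> F1 IH1 q1 r1; have [p p_n0 h] := IH1 q1 r1; exists p => // t s0.
  by move=> /h[delta d0 hd]; exists delta => // s /hd->.
Qed.

(** By quantifier elimination, every boundary point of a set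
    definable in the plane, taken along a vertical line, lies on one fixed
    algebraic curve. *)
Lemma holds_locally_constant (F : formula R) :
  exists2 p : {poly {poly R}}, p != 0 &
    forall t s0, p.[t%:P].[s0] != 0 ->
      exists2 delta : R, 0 < delta & forall s : R, `|s - s0| < delta ->
        holds [:: t; s] F <-> holds [:: t; s0] F.
Proof.
pose proj i bc := qe_rcf.qfr_to_formula (@qe_rcf.wproj R i bc).
pose G := quantifier_elim proj (to_rform F).
have GP e : reflect (holds e F) (qf_eval e G).
  exact: (proj_satP (@qe_rcf.wf_QE_wproj R) (@qe_rcf.valid_QE_wproj R)).
have /andP[qfG rG] : qf_form G && rformula G.
  exact: (quantifier_elim_wf (@qe_rcf.wf_QE_wproj R) (to_rform_rformula F)).
have [p p_n0 hp] := qf_locally_constant qfG rG.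
exists p => // t s0 /hp[delta d0 hd]; exists delta => // s /hd E.
by split=> /GP H; apply/GP; rewrite ?E // -E.
Qed.

End LocalConstancy.

Section ZeroSetBound.
Variable R : realFieldType.

Lemma horner_bounded01 (p : {poly R}) :
  exists2 M : R, 0 <= M & forall x : R, 0 <= x <= 1 -> `|p.[x]| <= M.
Proof.
elim/poly_ind: p => [|p c [M M_ge0 hM]].
  by exists 0 => // x _; rewrite horner0 normr0.
exists (M + `|c|); first by rewrite addr_ge0.
move=> x x01; rewrite hornerMXaddC (le_trans (ler_normD _ _)) // lerD2r normrM.
have /andP[x0 x1] := x01.
by rewrite -[M]mulr1 ler_pM // ?hM // ger0_norm.
Qed.

Lemma bihorner_bounded01 (p : {poly {poly R}}) :
  exists2 M : R, 0 <= M &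
    forall t s : R, 0 <= t <= 1 -> 0 <= s <= 1 -> `|p.[t%:P].[s]| <= M.
Proof.
elim/poly_ind: p => [|p c [M M_ge0 hM]].
  by exists 0 => // t s _ _; rewrite !horner0 normr0.
have [N N_ge0 hN] := horner_bounded01 c.
exists (M + N); first by rewrite addr_ge0.
move=> t s t01 s01; rewrite hornerMXaddC hornerD hornerM hornerC.
rewrite (le_trans (ler_normD _ _)) // lerD ?hN // normrM.
have /andP[t0 t1] := t01.
by rewrite -[M]mulr1 ler_pM // ?hM // ger0_norm.
Qed.

Lemma Xn_factor (A : idomainType) (p : {poly A}) : p != 0 ->
  exists k q, p = 'X^k * q /\ q`_0 != 0.
Proof.
move=> p0; have [k [q q0 ->]] := multiplicity_XsubC p 0; exists k, q.
by rewrite subr0 mulrC -horner_coef0; split=> //; rewrite p0 in q0.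
Qed.

(** This replaces Puiseux expansions. After division by a power of [t], the
    curve reads [s ^ k * u s + t * q1 (t, s) = 0] with [u 0 != 0]; near the
    origin [u] is bounded away from 0 and [q1] is bounded, so that
    [s ^ k <= C * t]. The exponent is raised to [k.+1] in order to be positive
    even when [k = 0], that is, when the curve misses the origin. *)
Lemma zero_set_power_bound (p : {poly {poly R}}) : p != 0 ->
  exists (k : nat) (C eta : R), [/\ 0 < C, 0 < eta &
    forall t s : R, 0 < t <= 1 -> 0 <= s <= eta -> p.[t%:P].[s] = 0 ->
      s ^+ k.+1 <= C * t].
Proof.
move=> /Xn_factor[v [q [-> q00]]].
have [k [u [q0E u00]]] := Xn_factor q00.
have [q1 qE] : exists q1, q = q1 * 'X + ('X^k * u)%:P.
  by exists (drop_poly 1 q); rewrite -q0E -{1}(poly_take_drop 1 q) addrC expr1;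
     congr (_ + _); apply/polyP => i; rewrite coef_take_poly coefC; case: i.
have [u1 uE] : exists u1, u = u1 * 'X + (u`_0)%:P.
  by exists (drop_poly 1 u); rewrite -{1}(poly_take_drop 1 u) addrC expr1;
     congr (_ + _); apply/polyP => i; rewrite coef_take_poly coefC; case: i.
have [M M_ge0 hM] := bihorner_bounded01 q1.
have [N N_ge0 hN] := horner_bounded01 u1.
pose a := `|u`_0|; have a_gt0 : 0 < a by rewrite normr_gt0.
exists k, ((2 * M + 1) / a), (Num.min 1 (a / (2 * (N + 1)))).
split.
- by rewrite divr_gt0 // ltr_wpDl // mulr_ge0.
- by rewrite lt_min ltr01 divr_gt0 // mulr_gt0 // ltr_wpDl.
move=> t s /andP[t_gt0 t_le1] /andP[s_ge0]; rewrite le_min => /andP[s_le1 s_lea].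
have s01 : 0 <= s <= 1 by rewrite s_ge0.
have t01 : 0 <= t <= 1 by rewrite t_le1 (ltW t_gt0).
rewrite hornerM hornerXn hornerM horner_exp hornerC => /eqP.
rewrite mulf_eq0 expf_eq0 (gt_eqF t_gt0) andbF /= qE.
rewrite hornerMXaddC hornerD !hornerM hornerXn hornerC => /eqP.
move=> /eqP; rewrite addrC addr_eq0 => /eqP /(congr1 Num.norm).
rewrite normrN !normrM (ger0_norm (exprn_ge0 _ s_ge0)) (gtr0_norm t_gt0) => E.
have us : a / 2 <= `|u.[s]|.
  rewrite uE hornerMXaddC addrC.
  apply: le_trans (lerB_normD _ _); rewrite -/a.
  suff : `|u1.[s] * s| <= a / 2 by lra.
  rewrite normrM (ger0_norm s_ge0).
  have : `|u1.[s]| * s <= (N + 1) * (a / (2 * (N + 1))).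
    by rewrite ler_pM // (le_trans (hN _ s01)) // lerDl.
  move=> /le_trans; apply.
  by rewrite le_eqVlt; apply/orP; left; apply/eqP; field; rewrite gt_eqF // ltr_wpDl.
have sk : s ^+ k * (a / 2) <= M * t.
  apply: (le_trans (ler_wpM2l (exprn_ge0 _ s_ge0) us)).
  by rewrite E ler_wpM2r ?hM // ltW.
have : s ^+ k.+1 <= s ^+ k.
  by rewrite exprS -[leRHS]mul1r ler_wpM2r // exprn_ge0.
move=> /le_trans; apply.
rewrite mulrAC ler_pdivlMr //.
have : 0 <= t by apply: ltW.
lra.
Qed.

End ZeroSetBound.

(** * First-order definable relations and their rate of decay *)

Section Definability.
Import ordered_qelim.ord.
Variable R : rcfType.
Implicit Types (P Q : (nat -> R) -> Prop) (T : (nat -> R) -> R).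

(** Environments are total functions of the variable index; [nth 0] turns the
    finite environments of the evaluation functions into such functions. *)
Definition definable P := exists F : formula R,
  forall e : seq R, P (nth 0 e) <-> holds e F.

Definition term_function T := exists u : GRing.term R,
  forall e : seq R, T (nth 0 e) = GRing.eval e u.

Lemma term_function_var i : term_function (fun e => e i).
Proof. by exists (GRing.Var R i). Qed.

Lemma term_function_cst c : term_function (fun=> c).
Proof. by exists (GRing.Const c). Qed.

Lemma term_functionD T1 T2 : term_function T1 -> term_function T2 ->
  term_function (fun e => T1 e + T2 e).
Proof. by move=> [u1 h1] [u2 h2]; exists (GRing.Add u1 u2) => e /=; rewrite h1 h2. Qed.

Lemma term_functionN T : term_function T -> term_function (fun e => - T e).
Proof. by move=> [u h]; exists (GRing.Opp u) => e /=; rewrite h. Qed.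

Lemma term_functionM T1 T2 : term_function T1 -> term_function T2 ->
  term_function (fun e => T1 e * T2 e).
Proof. by move=> [u1 h1] [u2 h2]; exists (GRing.Mul u1 u2) => e /=; rewrite h1 h2. Qed.

Lemma term_functionX T k : term_function T -> term_function (fun e => T e ^+ k).
Proof. by move=> [u h]; exists (GRing.Exp u k) => e /=; rewrite h. Qed.

Lemma term_function_sum (I : Type) (r : seq I) (T : I -> (nat -> R) -> R) :
  (forall i, term_function (T i)) ->
  term_function (fun e => \sum_(i <- r) T i e).
Proof.
move=> hT; elim: r => [|i r [u IH]].
  by exists (GRing.Const 0) => e; rewrite big_nil.
have [v hv] := hT i.
by exists (GRing.Add v u) => e; rewrite big_cons hv IH.
Qed.

Lemma term_function_prod (I : Type) (r : seq I) (T : I -> (nat -> R) -> R) :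
  (forall i, term_function (T i)) ->
  term_function (fun e => \prod_(i <- r) T i e).
Proof.
move=> hT; elim: r => [|i r [u IH]].
  by exists (GRing.Const 1) => e; rewrite big_nil.
have [v hv] := hT i.
by exists (GRing.Mul v u) => e; rewrite big_cons hv IH.
Qed.

Lemma term_function_meval n (p : mpoly n R) (T : 'I_n -> (nat -> R) -> R) :
  (forall i, term_function (T i)) ->
  term_function (fun e => meval (fun i => T i e) p).
Proof.
move=> hT.
have -> : (fun e => meval (fun i => T i e) p) =
    (fun e => \sum_(m <- msupp p) mcoeff m p * \prod_i T i e ^+ fun_of_multinom m i).
  by apply/funext => e; rewrite mevalE.
apply: term_function_sum => m; apply: term_functionM; first exact: term_function_cst.
by apply: term_function_prod => i; exact: term_functionX.
Qed.

Lemma eq_definable P Q : (forall e, P e <-> Q e) -> definable P -> definable Q.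
Proof. by move=> PQ [F hF]; exists F => e; rewrite -PQ. Qed.

Lemma definable_le T1 T2 : term_function T1 -> term_function T2 ->
  definable (fun e => T1 e <= T2 e).
Proof. by move=> [u1 h1] [u2 h2]; exists (Le u1 u2) => e /=; rewrite h1 h2. Qed.

Lemma definable_eq T1 T2 : term_function T1 -> term_function T2 ->
  definable (fun e => T1 e = T2 e).
Proof. by move=> [u1 h1] [u2 h2]; exists (Equal u1 u2) => e /=; rewrite h1 h2. Qed.

Lemma definable_and P Q : definable P -> definable Q ->
  definable (fun e => P e /\ Q e).
Proof. by move=> [F hF] [G hG]; exists (And F G) => e /=; rewrite hF hG. Qed.

Lemma definable_not P : definable P -> definable (fun e => ~ P e).
Proof. by move=> [F hF]; exists (Not F) => e /=; rewrite hF. Qed.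

Lemma definable_imply P Q : definable P -> definable Q ->
  definable (fun e => P e -> Q e).
Proof. by move=> [F hF] [G hG]; exists (Implies F G) => e /=; rewrite hF hG. Qed.

Lemma definable_forall_fin (I : finType) (P : I -> (nat -> R) -> Prop) :
  (forall i, definable (P i)) -> definable (fun e => forall i, P i e).
Proof.
move=> hP.
suff hs (r : seq I) : definable (fun e => forall i, i \in r -> P i e).
  apply: eq_definable (hs (enum I)) => e; split=> h i; last by move=> _; exact: h.
  by apply: h; rewrite mem_enum.
elim: r => [|i r IH]; first by exists (Bool true).
apply: eq_definable (definable_and (hP i) IH) => e; split.
  by move=> [Pi Pr] j; rewrite inE => /predU1P[->//|]; exact: Pr.
by move=> h; split=> [|j jr]; apply: h; rewrite inE ?eqxx ?jr ?orbT.
Qed.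

Lemma definable_exists_var i P : definable P ->
  definable (fun e => exists x, P (fun j => if j == i then x else e j)).
Proof.
move=> [F hF]; exists (Exists i F) => e /=.
have E x : (fun j => if j == i then x else nth 0 e j) = nth 0 (set_nth 0 e i x).
  by apply/funext => j; rewrite nth_set_nth.
by split=> -[x]; [rewrite E => /hF | move=> /hF; rewrite -E]; exists x.
Qed.

(** The effect on the environment of [n] nested quantifiers over consecutive
    variables. *)
Definition splice k n (y e : nat -> R) : nat -> R :=
  fun j => if (k <= j < k + n)%N then y (j - k)%N else e j.

Lemma definable_exists_splice k n P : definable P ->
  definable (fun e => exists y, P (splice k n y e)).
Proof.
elim: n P => [|n IH] P hP.
  apply: eq_definable hP => e.
  have E y : splice k 0 y e = e.
    by apply/funext => j; rewrite /splice addn0; case: leqP => //=; case: ltnP.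
  by split=> [Pe|[y]]; [exists (fun=> 0)|]; rewrite E.
apply: eq_definable (IH _ (definable_exists_var (k + n) hP)) => e.
have E y x : (fun j => if j == (k + n)%N then x else splice k n y e j) =
    splice k n.+1 (fun j => if j == n then x else y j) e.
  apply/funext => j; rewrite /splice addnS ltnS.
  have [->|jn] := eqVneq j (k + n)%N.
    by rewrite leq_addr leqnn addKn eqxx.
  rewrite (leq_eqVlt j) (negbTE jn) /=.
  case: ifP => // /andP[kj _]; case: ifP => // /eqP jkn.
  by move: jn; rewrite -jkn subnKC // eqxx.
split=> [[y [x]]|[y]].
  by rewrite E => Px; exists (fun j => if j == n then x else y j).
move=> Py; exists y, (y n); rewrite E.
by rewrite (_ : (fun j => _) = y) //; apply/funext => j; case: eqP => // ->.
Qed.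

Definition block n k (e : nat -> R) : 'rV[R]_n := \row_i e (k + i)%N.

(** The variables from [k] on serve as fresh names for the coordinates of the
    quantified vector; the first hypothesis says that [Q] has no free variable
    among them. *)
Lemma definable_exists_vector n k (Q : (nat -> R) -> 'rV[R]_n -> Prop) :
  (forall e e', (forall j, (j < k)%N -> e j = e' j) ->
    forall v, Q e v -> Q e' v) ->
  definable (fun e => Q e (block n k e)) ->
  definable (fun e => exists v, Q e v).
Proof.
move=> Qloc hQ; apply: eq_definable (definable_exists_splice k n hQ) => e.
have spliceE y j : (j < k)%N -> splice k n y e j = e j.
  by move=> jk; rewrite /splice leqNgt jk.
split=> [[y Qy]|[v Qv]].
  by exists (block n k (splice k n y e)); apply: Qloc Qy => j; exact: spliceE.
exists (fun j => if insub j is Some i then v 0 i else 0).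
rewrite (_ : block _ _ _ = v); first by apply: Qloc Qv => j jk; rewrite spliceE.
apply/rowP => i; rewrite mxE /splice leq_addr ltn_add2l ltn_ord addKn /=.
by rewrite valK.
Qed.

Lemma definable_forall_vector n k (Q : (nat -> R) -> 'rV[R]_n -> Prop) :
  (forall e e', (forall j, (j < k)%N -> e j = e' j) ->
    forall v, Q e v <-> Q e' v) ->
  definable (fun e => Q e (block n k e)) ->
  definable (fun e => forall v, Q e v).
Proof.
move=> Qloc hQ.
have ex : definable (fun e => exists v, ~ Q e v).
  apply: (@definable_exists_vector n k); last exact: definable_not.
  by move=> e e' ee v nQ Qe'; apply: nQ; apply/(Qloc e e' ee).
apply: eq_definable (definable_not ex) => e; split=> [nex v|Qe [v nQ]].
  by apply: contrapT => nQ; apply: nex; exists v.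
exact: nQ (Qe v).
Qed.

Lemma term_function_block n k (i : 'I_n) :
  term_function (fun e : nat -> R => block n k e 0 i).
Proof.
by exists (GRing.Var R (k + i)%N) => e; rewrite mxE.
Qed.

End Definability.

Section VanishingRate.
Variable R : realType.

(** A definable family that shrinks to [0] does so at a power rate.
    The supremum [phi t] of the slice at [t] is a boundary point of that slice,
    hence lies on a fixed algebraic curve, and [phi] tends to 0 with [t], so it
    stays in the range where the curve satisfies a power bound. *)
Lemma definable_vanishing_rate (D : R -> R -> Prop) :
  definable (fun e => D (e 0) (e 1)) ->
  (forall t : R, 0 < t -> D t 0) ->
  (forall eta : R, 0 < eta -> exists2 delta : R, 0 < delta &
     forall t s, 0 < t < delta -> D t s -> s <= eta) ->
  exists (k : nat) (C delta : R), [/\ 0 < C, 0 < delta & forall t s : R,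
     0 < t < delta -> 0 <= s -> D t s -> s ^+ k.+1 <= C * t].
Proof.
move=> [F DF] D0 Dsmall.
have DE t s : D t s <-> ordered_qelim.ord.holds [:: t; s] F by exact: DF [:: t; s].
have [p p_n0 p_const] := holds_locally_constant F.
have [k [C [eta [C_gt0 eta_gt0 rate]]]] := zero_set_power_bound p_n0.
have [delta delta_gt0 Dle] := Dsmall _ eta_gt0.
exists k, C, (Num.min 1 delta); split=> //; first by rewrite lt_min ltr01.
move=> t s /andP[t_gt0]; rewrite lt_min => /andP[t_lt1 t_ltd] s_ge0 Dts.
pose A := [set x | D t x].
have supA : has_sup A.
  split; first by exists 0; exact: D0.
  by exists eta => x; apply: Dle; rewrite t_gt0.
have A_le_sup x : D t x -> x <= sup A by move=> Dx; apply: sup_upper_bound.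
have phi_ge0 : 0 <= sup A by apply: A_le_sup; exact: D0.
have phi_le : sup A <= eta.
  by apply: ge_sup => [|x]; [case: supA | apply: Dle; rewrite t_gt0].
have : p.[t%:P].[sup A] = 0.
  apply/eqP/negPn/negP => /p_const[d d_gt0 const].
  have [x Dx x_gt] := sup_adherent d_gt0 supA.
  have Dphi : ordered_qelim.ord.holds [:: t; sup A] F.
    apply/(const x); last exact/DE.
    by rewrite ler0_norm ?subr_le0 ?A_le_sup // opprB ltrBlDl -ltrBlDr.
  have /A_le_sup : D t (sup A + d / 2).
    apply/DE; apply/(const (sup A + d / 2)) => //.
    rewrite addrAC subrr add0r gtr0_norm ?divr_gt0 //.
    by rewrite ltr_pdivrMr // ltr_pMr // ltr1n.
  by rewrite gerDl leNgt divr_gt0.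
move=> phi_root.
have : s ^+ k.+1 <= sup A ^+ k.+1.
  by rewrite lerXn2r ?nnegrE //; exact: A_le_sup.
move=> /le_trans; apply; apply: rate => //; first by rewrite t_gt0 ltW.
by rewrite phi_ge0.
Qed.

End VanishingRate.

(** * Polynomial estimates and compactness *)

Section PolynomialEstimates.
Variables (R : realType) (n : nat).
Implicit Types (f g h : mpoly n R) (x y v : 'rV[R]_n) (m : multinom n).

Definition monomial_eval m x : R := \prod_i x 0 i ^+ m i.

Lemma pevalE h x :
  peval h x = \sum_(m <- msupp h) mcoeff m h * monomial_eval m x.
Proof. by rewrite /peval mevalE. Qed.

Lemma pevalB f g x : peval (f - g) x = peval f x - peval g x.
Proof. by rewrite /peval mevalB. Qed.

Lemma coord_le_norm x i : `|x 0 i| <= `|x|.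
Proof.
have := @mx_normrE R 1 n x; rewrite [`|x|]/Num.norm /= => ->.
by apply: (bigmax_sup (0, i)).
Qed.

Lemma norm_le_coord (M : R) x : 0 <= M ->
  `|x| <= M <-> forall i, - M <= x 0 i /\ x 0 i <= M.
Proof.
move=> M_ge0; split=> [xM i|xM].
  by apply/andP; rewrite -ler_norml (le_trans (coord_le_norm x i)).
rewrite [`|x|]/Num.norm /= mx_normrE; apply: bigmax_le => // -[i j] _ /=.
by rewrite ord1 ler_norml; apply/andP.
Qed.

Lemma monomial_evalZ m c x :
  monomial_eval m (c *: x) = c ^+ mdeg m * monomial_eval m x.
Proof.
rewrite /monomial_eval mdegE -prodrXr -big_split /=.
by apply: eq_bigr => i _; rewrite mxE exprMn.
Qed.

Lemma monomial_eval_bound m x (X : R) : `|x| <= X ->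
  `|monomial_eval m x| <= X ^+ mdeg m.
Proof.
move=> xX; rewrite /monomial_eval normr_prod mdegE -prodrXr.
apply: ler_prod => i _; rewrite normr_ge0 normrX lerXn2r ?nnegrE //.
  exact: le_trans xX.
exact: le_trans (coord_le_norm x i) xX.
Qed.

Lemma mdeg_le_pdeg h m : m \in msupp h -> (mdeg m <= pdeg h)%N.
Proof. by move=> /msize_mdeg_lt; rewrite /pdeg; case: mmeasure. Qed.

Lemma pdeg_sub_le f g (e : nat) :
  (0 < e)%N -> (pdeg f <= e)%N -> (pdeg g <= e)%N -> (pdeg (g - f)%R <= e)%N.
Proof.
move=> e_gt0 fe ge; have le (h : mpoly n R) : (pdeg h <= e)%N -> (mmeasure mdeg h <= e.+1)%N.
  by rewrite /pdeg; case: mmeasure.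
apply: (@leq_trans e.+1.-1) => //; rewrite /pdeg -!subn1 leq_sub2r //.
by rewrite (leq_trans (mmeasureD_le _ _ _)) // mmeasureN geq_max !le.
Qed.

Lemma coef_le_norm h m : m \in msupp h -> `|mcoeff m h| <= coef_norm h.
Proof.
move=> mh; rewrite -sqrtr_sqr ler_sqrt ?sumr_ge0 // => [|i _]; last exact: sqr_ge0.
rewrite (bigD1_seq m) ?msupp_uniq //= lerDl sumr_ge0 // => i _.
exact: sqr_ge0.
Qed.

Lemma coef_norm_ge0 h : 0 <= coef_norm h.
Proof. exact: sqrtr_ge0. Qed.

Lemma size_msupp_bound h e : (pdeg h <= e)%N ->
  (size (msupp h) <= #|{: bmultinom n e.+1}|)%N.
Proof.
move=> he; rewrite cardE -(size_map val (enum {: bmultinom n e.+1})).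
apply: uniq_leq_size => [|m mh]; first exact: msupp_uniq.
have mlt : (mdeg m < e.+1)%N by rewrite ltnS (leq_trans (mdeg_le_pdeg mh)).
by apply/mapP; exists (BMultinom mlt) => //; rewrite mem_enum.
Qed.

(** The constant is uniform in [h] because polynomials of degree at most [e]
    share the same finite set of monomials. *)
Lemma peval_bound e : exists2 N : R, 0 < N &
  forall h x (X : R), (pdeg h <= e)%N -> 1 <= X -> `|x| <= X ->
    `|peval h x| <= N * coef_norm h * X ^+ e.
Proof.
pose N := #|{: bmultinom n e.+1}|.
exists N.+1%:R => // h x X he X1 xX.
have X0 : 0 <= X by apply: le_trans X1.
rewrite pevalE (le_trans (ler_norm_sum _ _ _)) //.
apply: (@le_trans _ _ (\sum_(m <- msupp h) coef_norm h * X ^+ e)).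
  rewrite big_seq [leRHS]big_seq; apply: ler_sum => m mh.
  rewrite normrM ler_pM ?coef_le_norm //.
  rewrite (le_trans (monomial_eval_bound m xX)) // ler_weXn2l //.
  exact: leq_trans (mdeg_le_pdeg mh) he.
rewrite big_const_seq count_predT iter_addr_0 -[leLHS]mulr_natl mulrA.
rewrite !ler_wpM2r ?exprn_ge0 ?coef_norm_ge0 // ler_nat.
exact: leq_trans (size_msupp_bound he) _.
Qed.

Lemma peval_leading_formZ f c x :
  peval (leading_form f) (c *: x) = c ^+ pdeg f * peval (leading_form f) x.
Proof.
rewrite !pevalE mulr_sumr big_seq [RHS]big_seq; apply: eq_bigr => m mf.
have /dhomogP/(_ m mf)/= <- := pihomogP mdeg (pdeg f) f.
by rewrite monomial_evalZ mulrCA.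
Qed.

Lemma mcoeff_leading_form f m :
  mcoeff m (leading_form f) = if mdeg m == pdeg f then mcoeff m f else 0.
Proof.
rewrite /leading_form pihomogE raddf_sum /= big_mkcond /=.
rewrite (eq_bigr (fun m' => if m' == m then
    if mdeg m == pdeg f then mcoeff m f else 0 else 0)); last first.
  move=> m' _; rewrite mcoeffZ mcoeffX.
  by have [->|_] := eqVneq m' m; [rewrite mulr1|rewrite mulr0 if_same].
rewrite -big_mkcond /=.
have [mf|mf] := boolP (m \in msupp f).
  by rewrite -big_filter filter_pred1_uniq ?msupp_uniq // big_seq1.
rewrite big_seq_cond big_pred0 => [|m']; first by rewrite memN_msupp_eq0 ?if_same.
by case: eqVneq mf => [->|_ _]; rewrite ?andbT ?andbF // => /negbTE.
Qed.

Lemma pdeg_sub_leading_form f : (0 < pdeg f)%N ->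
  (pdeg (f - leading_form f)%R <= (pdeg f).-1)%N.
Proof.
move=> d_gt0; rewrite {1}/pdeg -!subn1 leq_sub2r // mmeasureE.
rewrite big_seq; apply: (big_ind (fun k => (k <= pdeg f)%N)) => //.
  by move=> a b ha hb; rewrite geq_max ha hb.
move=> m; rewrite mcoeff_msupp mcoeffB mcoeff_leading_form.
case: ltngtP => // [lt_m|_]; last by rewrite subrr eqxx.
rewrite subr0 -mcoeff_msupp => /mdeg_le_pdeg.
by rewrite leqNgt lt_m.
Qed.

Lemma coord_cvg (u : nat -> 'rV[R]_n) v i :
  u @ \oo --> v -> (fun k => u k 0 i) @ \oo --> v 0 i.
Proof.
move=> uv; apply: (@cvg_comp _ _ _ u (fun x : 'rV[R]_n => x 0 i) _ _ _ uv).
exact: (@coord_continuous R 1 n 0 i v).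
Qed.

Lemma peval_cvg h (u : nat -> 'rV[R]_n) v :
  u @ \oo --> v -> (fun k => peval h (u k)) @ \oo --> peval h v.
Proof.
move=> uv; rewrite pevalE.
rewrite (_ : (fun k => _) = fun k =>
    \sum_(m <- msupp h) mcoeff m h * monomial_eval m (u k)); last first.
  by apply/funext => k; rewrite pevalE.
apply: cvg_big => [|m _]; first exact: add_continuous.
apply: cvgM; first exact: cvg_cst.
rewrite /monomial_eval; apply: cvg_big => [|i _]; first exact: mul_continuous.
have ui : (fun k => u k 0 i) @ \oo --> v 0 i by exact: coord_cvg.
apply: (@cvg_comp _ _ _ (fun k => u k 0 i) (fun r : R => r ^+ m i) _ _ _ ui).
exact: exprn_continuous.
Qed.

End PolynomialEstimates.

Section Compactness.
Variables (R : realType) (n : nat).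

(** The inequality [j <= sigma j] carries rates such as 1/(k+1) over to the
    extracted sequence. *)
Lemma bounded_extraction (u : nat -> 'rV[R]_n) (M : R) :
  (forall k, `|u k| <= M) ->
  exists (v : 'rV[R]_n) (sigma : nat -> nat),
    (forall j, (j <= sigma j)%N) /\ (fun j => u (sigma j)) @ \oo --> v.
Proof.
move=> uM; pose A := [set x : 'rV[R]_n | `|x| <= M].
have cA : compact A.
  apply: bounded_closed_compact.
    exists M; split=> [|x Mx y yM]; first exact: num_real.
    exact: le_trans yM (ltW Mx).
  by rewrite /A (_ : [set _ | _] = Num.norm @^-1` [set r | r <= M]) //;
     apply: closed_comp => [x _|]; [exact: norm_continuous|exact: closed_le].
have [v [_ clv]] : A `&` cluster (u @ \oo) !=set0.
  by apply: cA; exists 0%N => // k _; exact: uM.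
have step j : exists k, (j <= k)%N /\ ball v j.+1%:R^-1 (u k).
  have tail : (u @ \oo) (u @` [set k | (j <= k)%N]).
    by exists j => // k /= jk; exists k.
  have e0 : 0 < j.+1%:R^-1 :> R by rewrite invr_gt0.
  by have [_ [[k jk <-] vy]] := clv _ _ tail (nbhsx_ballx v _ e0); exists k.
have [sigma hs] := choice step.
exists v, sigma; split=> [j|]; first by case: (hs j).
apply/cvgrPdist_lt => e e0; near=> j.
have [_] := hs j; rewrite -ball_normE /= => /lt_trans; apply.
near: j; have /cvgrPdist_lt/(_ e e0) := @cvg_harmonic R.
by apply: filterS => j; rewrite sub0r normrN ger0_norm /harmonic ?invr_ge0.
Unshelve. all: by end_near.
Qed.

End Compactness.

(** * Coercivity from regularity *)

Section Coercivity.
Variables (R : realType) (n : nat) (f : mpoly n R) (K : set 'rV[R]_n).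
Hypothesis d_gt0 : (0 < pdeg f)%N.
Local Notation d := (pdeg f).

(** If the leading form were negative at the limit of [x k / t k], then
    [f (x k)] would behave like a negative multiple of [t k ^ d] and would drop
    below [w]. *)
Lemma leading_form_ge0_cone (w : R) v : (forall x, K x -> w <= peval f x) ->
  asymptotic_cone K v -> 0 <= peval (leading_form f) v.
Proof.
have sum_bound (a b c e r : R) : a <= - b -> c <= e -> e + r + 1 <= b ->
  a + c <= - (r + 1) by lra.
move=> fw [t [x [t_oo Kx u_v]]]; rewrite leNgt; apply/negP => lf_lt0.
set u := fun k => (t k)^-1 *: x k in u_v.
have t_ge A : \forall k \near \oo, A <= t k by move: A; exact/cvgryPge.
have [N N_gt0 hN] := @peval_bound R n d.-1.
pose B := `|v| + 1; pose a := - peval (leading_form f) v / 2.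
pose C := N * coef_norm (f - leading_form f) * B ^+ d.-1.
have B1 : 1 <= B by rewrite lerDr.
have a_gt0 : 0 < a by rewrite divr_gt0 // oppr_gt0.
have u_le : \forall k \near \oo, `|u k| <= B.
  by apply: (cvgr_le _ (cvg_norm u_v)); rewrite ltrDl.
have lfu_lt : \forall k \near \oo, peval (leading_form f) (u k) < - a.
  by apply: (cvgr_lt _ (peval_cvg u_v)); rewrite /a; lra.
suff : \forall k \near \oo, False by case=> k0 _ /(_ k0 (leqnn _)).
near=> k.
have t1 : 1 <= t k by near: k; exact: t_ge.
have tC : (`|C| + `|w| + 1) / a <= t k by near: k; exact: t_ge.
have lfu : peval (leading_form f) (u k) < - a.
  by near: k; exact: lfu_lt.
have uB : `|u k| <= B.
  by near: k; exact: u_le.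
have t_gt0 : 0 < t k by exact: lt_le_trans t1.
have xE : x k = t k *: u k by rewrite scalerA divff ?gt_eqF // scale1r.
have xB : `|x k| <= B * t k.
  by rewrite xE normrZ gtr0_norm // mulrC ler_wpM2r // ltW.
have Bt1 : 1 <= B * t k by rewrite -[1]mulr1 ler_pM.
have := hN _ _ _ (pdeg_sub_leading_form d_gt0) Bt1 xB.
rewrite pevalB exprMn mulrA -/C => /ler_normlW rem.
have wx := fw _ (Kx k).
move: rem; rewrite [X in peval (leading_form f) X]xE peval_leading_formZ.
rewrite -[in t k ^+ d](prednK d_gt0) exprSr => rem.
have p1 : 1 <= t k ^+ d.-1 by rewrite exprn_ege1.
move: tC; rewrite ler_pdivrMr // => tC.
have ineq : t k ^+ d.-1 * (t k * peval (leading_form f) (u k) + C) <= - (`|w| + 1).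
  apply: (@le_trans _ _ (t k ^+ d.-1 * - (`|w| + 1))).
    rewrite ler_wpM2l ?exprn_ge0 ?(ltW t_gt0) //.
    by apply: sum_bound (ler_norm C) tC; rewrite -mulrN ler_wpM2l // ltW.
  by rewrite mulrN lerN2 ler_peMl // addr_ge0.
have wf : w <= t k ^+ d.-1 * (t k * peval (leading_form f) (u k) + C).
  by rewrite mulrDr mulrA; apply: le_trans wx _; rewrite -lerBlDl [leRHS]mulrC.
have := le_trans wf ineq; rewrite leNgt => /negP; apply.
by rewrite ltrNl (le_lt_trans (ler_norm (- w))) // normrN ltrDl.
Unshelve. all: by end_near.
Qed.

Lemma asymptotic_coneZ (c : R) v : 0 < c ->
  asymptotic_cone K v -> asymptotic_cone K (c *: v).
Proof.
move=> c_gt0 [t [x [t_oo Kx u_v]]]; exists (fun k => t k / c), x.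
have t_ge A : \forall k \near \oo, A <= t k by move: A; exact/cvgryPge.
split=> //.
  apply/cvgryPge => A; near=> k; rewrite ler_pdivlMr //.
  by near: k; exact: t_ge.
rewrite (_ : (fun k => _) = (fun k => c *: ((t k)^-1 *: x k))).
  by apply: cvgZl_tmp.
by apply/funext => k; rewrite scalerA invfM invrK mulrC.
Unshelve. all: by end_near.
Qed.

(** A nonzero zero of the leading form in the cone spans a ray of minimizers,
    by homogeneity and nonnegativity, against the boundedness that regularity
    asserts. *)
Lemma leading_form_gt0_cone (w : R) v : (forall x, K x -> w <= peval f x) ->
  regular K f -> asymptotic_cone K v -> v != 0 -> 0 < peval (leading_form f) v.
Proof.
move=> fw [M [_ hM]] Cv v0; rewrite lt_def (leading_form_ge0_cone fw Cv) andbT.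
apply/eqP => lf0.
have v_gt0 : 0 < `|v| by rewrite normr_gt0.
pose c := (`|M| + 2) / `|v|.
have c_gt0 : 0 < c by rewrite divr_gt0 // ltr_wpDl.
have M1 : M < `|M| + 1 by rewrite (le_lt_trans (ler_norm M)) // ltrDl.
have : `|c *: v| <= `|M| + 1.
  apply: hM M1 _ _; split; first exact: asymptotic_coneZ.
  move=> y Cy; rewrite peval_leading_formZ lf0 mulr0.
  exact: leading_form_ge0_cone fw Cy.
by rewrite normrZ gtr0_norm // mulfVK ?gt_eqF //; lra.
Qed.

Lemma leading_form_coercive (w : R) : (forall x, K x -> w <= peval f x) ->
  regular K f ->
  exists c M : R, [/\ 0 < c, 1 <= M &
    forall x, K x -> M <= `|x| -> c * `|x| ^+ d <= peval (leading_form f) x].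
Proof.
move=> fw reg; apply: contrapT => noc.
(* Otherwise points of K going to infinity violate the bound with c = 1/(k+1);
   their directions accumulate at a unit vector of the asymptotic cone on which
   the leading form is not positive. *)
have step k : exists x, [/\ K x, k.+1%:R <= `|x| &
    peval (leading_form f) x < k.+1%:R^-1 * `|x| ^+ d].
  apply: contrapT => nox; apply: noc; exists k.+1%:R^-1, k.+1%:R; split=> //.
  - by rewrite ler1n.
  - move=> x Kx kx; rewrite leNgt; apply/negP => lt; apply: nox.
    by exists x.
have [x hx] := choice step.
have x_gt0 k : 0 < `|x k|.
  by have [_ kx _] := hx k; apply: lt_le_trans kx.
pose u k := `|x k|^-1 *: x k.
have u1 k : `|u k| = 1 by rewrite normrZ normfV normr_id mulVf // gt_eqF.
have [|v [sigma [sigma_ge u_v]]] := @bounded_extraction _ _ u 1.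
  by move=> k; rewrite u1.
have v0 : v != 0.
  rewrite -normr_gt0; apply: (lt_le_trans ltr01).
  apply: (ler_cvg_to (cvg_cst (1 : R)) (cvg_norm u_v)).
  by near=> j; rewrite u1.
have Cv : asymptotic_cone K v.
  exists (fun j => `|x (sigma j)|), (x \o sigma).
  split=> // [|j]; last by case: (hx (sigma j)).
  apply/cvgryPge => A; near=> j.
  have [_ le_x _] := hx (sigma j); apply: le_trans le_x.
  rewrite (@le_trans _ _ j%:R) //; last first.
    by rewrite ler_nat (leq_trans (sigma_ge j)) // leqnSn.
  by near: j; exact: nbhs_infty_ger.
have := leading_form_gt0_cone fw reg Cv v0; rewrite ltNge => /negP; apply.
apply: (ler_cvg_to (peval_cvg u_v) (@cvg_harmonic R)); near=> j.
rewrite peval_leading_formZ.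
have [_ _ lt] := hx (sigma j).
apply: (@le_trans _ _ (sigma j).+1%:R^-1).
  rewrite exprVn mulrC ler_pdivrMr ?exprn_gt0 //; exact: ltW.
by rewrite /harmonic lef_pV2 ?posrE ?ltr0n // ler_nat ltnS.
Unshelve. all: by end_near.
Qed.

(** The perturbation [g - f] contributes at most [N * coef_norm (g - f)] times
    [`|x| ^ d], which the coercivity of the leading form absorbs; so [g] exceeds
    [g x0] far away. *)
Lemma Sol_locally_bounded (x0 : 'rV[R]_n) : Sol K f x0 -> regular K f ->
  exists M eps : R, [/\ 1 <= M, 0 < eps, `|x0| <= M &
    forall g, (pdeg g <= d)%N -> coef_norm (g - f) < eps ->
      forall x, Sol K g x -> `|x| <= M].
Proof.
(* Arithmetic facts on plain variables: norms and powers take their places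
   below. *)
have growth (c fx lx gx cp e Q : R) : - cp <= fx - lx -> - e <= gx - fx ->
  c * Q <= lx -> e <= c / 2 * Q -> c / 2 * Q - cp <= gx by lra.
have threshold (c r C b : R) : 2 * (C + b + 1) < r * c -> b + 1 <= c / 2 * r - C.
  by lra.
have half (c e N : R) : e * (2 * N) <= c -> N * e <= c / 2 by lra.
move=> [Kx0 x0min] reg.
have [c [M0 [c_gt0 M0_ge1 coer]]] := leading_form_coercive x0min reg.
have [N N_gt0 hN] := @peval_bound R n d.
have [N1 N1_gt0 hN1] := @peval_bound R n d.-1.
pose C := N1 * coef_norm (f - leading_form f).
pose B := peval f x0 + N * (1 + `|x0|) ^+ d.
pose M := Num.max (Num.max M0 `|x0|) (2 * (C + `|B| + 1) / c).
exists M, (Num.min 1 (c / (2 * N))); split.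
- by rewrite /M !le_max M0_ge1.
- by rewrite lt_min ltr01 divr_gt0 // mulr_gt0.
- by rewrite /M !le_max lexx orbT.
move=> g gd; rewrite lt_min => /andP[gf1 gfc] x [Kx xmin].
rewrite leNgt; apply/negP; rewrite /M !gt_max => /andP[/andP[xM0 xx0] xC].
have x1 : 1 <= `|x| by rewrite (le_trans M0_ge1) // ltW.
have x_gt0 : 0 < `|x| by exact: lt_le_trans x1.
have gfd : (pdeg (g - f)%R <= d)%N by exact: pdeg_sub_le.
have b1 := hN1 _ _ _ (pdeg_sub_leading_form d_gt0) x1 (lexx _).
have b2 := hN _ _ _ gfd x1 (lexx _).
have b3 : `|peval (g - f) x0| <= N * coef_norm (g - f) * (1 + `|x0|) ^+ d.
  by apply: hN => //; rewrite ?lerDl ?lerDr.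
have b4 := coer _ Kx (ltW xM0).
have b5 := xmin _ Kx0.
have b6 : N * coef_norm (g - f) * (1 + `|x0|) ^+ d <= N * (1 + `|x0|) ^+ d.
  rewrite ler_wpM2r ?exprn_ge0 ?addr_ge0 //.
  by rewrite -[leRHS]mulr1 ler_wpM2l // ltW.
move: b1 b2 b3; rewrite !pevalB -/C !ler_norml => /andP[b1 _] /andP[b2 _] /andP[_ b3].
have b7 : N * coef_norm (g - f) <= c / 2.
  move: gfc; rewrite ltr_pdivlMr ?mulr_gt0 // => /ltW; exact: half.
have p1 : 1 <= `|x| ^+ d.-1 by rewrite exprn_ege1.
have b8 : N * coef_norm (g - f) * `|x| ^+ d <= c / 2 * `|x| ^+ d.
  by rewrite ler_wpM2r ?exprn_ge0.
move: b4 b2 b8; rewrite -[in `|x| ^+ d](prednK d_gt0) exprSr => b4 b2 b8.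
move: xC; rewrite ltr_pdivrMr // => /threshold xC.
have b9 : `|B| + 1 <= `|x| ^+ d.-1 * (c / 2 * `|x| - C).
  apply: (le_trans xC); rewrite ler_peMl // (le_trans _ xC) // addr_ge0 //.
have gx_large : `|B| + 1 <= peval g x.
  apply: le_trans (growth _ _ _ _ _ _ _ b1 b2 b4 b8).
  by apply: le_trans b9 _; rewrite mulrBr mulrCA [X in _ - X <= _]mulrC.
have gx0_le : peval g x0 <= B by rewrite -lerBlDl (le_trans b3).
have := le_trans gx_large (le_trans b5 gx0_le).
by rewrite leNgt => /negP; apply; rewrite (le_lt_trans (ler_norm B)) // ltrDl.
Qed.

End Coercivity.

(** * A Hoelderian error bound for sublevel sets *)

Section ErrorBound.
Variables (R : realType) (n : nat) (f : mpoly n R).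
Variables (s m : nat) (p : 'I_s -> mpoly n R) (q : 'I_m -> mpoly n R).
Variables (w M : R).

Definition basic_closed_set : set 'rV[R]_n :=
  [set x | (forall i, peval (p i) x = 0) /\ (forall j, peval (q j) x <= 0)].
Local Notation K := basic_closed_set.

Definition sqdist (x y : 'rV[R]_n) : R := \sum_i (x 0 i - y 0 i) ^+ 2.

(** The supremum of the admissible [r] is the squared distance by which relaxing
    the sublevel set by [t] can move a point away from it. Squared Euclidean
    distances keep the relation polynomial. *)
Definition sublevel_gap (t r : R) : Prop :=
  exists x, [/\ K x, `|x| <= M, peval f x <= w + t &
    forall y, K y -> peval f y <= w -> r <= sqdist x y].

Lemma term_function_peval k (g : mpoly n R) :
  term_function (fun e : nat -> R => peval g (block n k e)).
Proof.
apply: (term_function_meval g (T := fun i e => block n k e 0 i)) => i.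
exact: term_function_block.
Qed.

Lemma definable_basic_closed_set k :
  definable (fun e : nat -> R => K (block n k e)).
Proof.
apply: definable_and; apply: definable_forall_fin => i.
  by apply: definable_eq; [exact: term_function_peval|exact: term_function_cst].
by apply: definable_le; [exact: term_function_peval|exact: term_function_cst].
Qed.

Lemma definable_sublevel_gap : 0 <= M ->
  definable (fun e => sublevel_gap (e 0%N) (e 1%N)).
Proof.
move=> M_ge0; apply: (@definable_exists_vector _ _ 2).
  by move=> e e' ee x; rewrite !ee.
have K2 := definable_basic_closed_set 2.
have box : definable (fun e : nat -> R => `|block n 2 e| <= M).
  apply: (@eq_definable _ (fun e : nat -> R =>
      forall i, - M <= block n 2 e 0 i /\ block n 2 e 0 i <= M)).
    by move=> e; split=> /norm_le_coord; exact.
  apply: definable_forall_fin => i; apply: definable_and; apply: definable_le;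
    by [exact: term_function_cst|exact: term_function_block].
have sub : definable (fun e : nat -> R => peval f (block n 2 e) <= w + e 0%N).
  apply: definable_le; first exact: term_function_peval.
  by apply: term_functionD; [exact: term_function_cst|exact: term_function_var].
have far : definable (fun e : nat -> R => forall y, K y -> peval f y <= w ->
    e 1%N <= sqdist (block n 2 e) y).
  apply: (@definable_forall_vector _ _ (2 + n)) => [e e' ee y|].
    rewrite (_ : block n 2 e = block n 2 e') ?ee //.
    by apply/rowP => i; rewrite !mxE ee // ltn_add2l.
  apply: definable_imply; first exact: definable_basic_closed_set.
  apply: definable_imply.
    by apply: definable_le; [exact: term_function_peval|exact: term_function_cst].
  apply: definable_le; first exact: term_function_var.
  apply: term_function_sum => i; apply: term_functionX; apply: term_functionD.
    exact: term_function_block.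
  by apply: term_functionN; exact: term_function_block.
have := definable_and (definable_and K2 box) (definable_and sub far).
apply: eq_definable => e; split; first by move=> [[? ?] [? ?]]; split.
by move=> [? ? ? ?]; do 2 split.
Qed.

Lemma cvg_peval_le (h : mpoly n R) (u : nat -> 'rV[R]_n) v (a : nat -> R) b :
  u @ \oo --> v -> a @ \oo --> b -> (forall k, peval h (u k) <= a k) ->
  peval h v <= b.
Proof.
by move=> uv ab le; apply: (ler_cvg_to (peval_cvg uv) ab); near=> k.
Unshelve. all: by end_near.
Qed.

Lemma sqdist_cvg (u : nat -> 'rV[R]_n) v : u @ \oo --> v ->
  (fun k => sqdist (u k) v) @ \oo --> 0.
Proof.
move=> uv.
have -> : 0 = \sum_i (v 0 i - v 0 i) ^+ 2 :> R.
  by rewrite big1 // => i _; rewrite subrr expr0n.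
apply: cvg_big => [|i _]; first exact: add_continuous.
have ui : (fun k => u k 0 i - v 0 i) @ \oo --> v 0 i - v 0 i.
  by apply: cvgB; [exact: coord_cvg|exact: cvg_cst].
apply: (@cvg_comp _ _ _ (fun k => u k 0 i - v 0 i) (fun r : R => r ^+ 2) _ _ _ ui).
exact: exprn_continuous.
Qed.

(** Points realizing a gap larger than [eta] for [t] tending to 0 accumulate, by
    compactness, at a point of the sublevel set, from which they were supposed
    to stay away. *)
Lemma sublevel_gap_vanishes (eta : R) : 0 < eta ->
  exists2 delta : R, 0 < delta &
    forall t r, 0 < t < delta -> sublevel_gap t r -> r <= eta.
Proof.
move=> eta_gt0; apply: contrapT => no_delta.
have step k : exists x, [/\ K x, `|x| <= M, peval f x <= w + k.+1%:R^-1 &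
    forall y, K y -> peval f y <= w -> eta <= sqdist x y].
  apply: contrapT => nox; apply: no_delta; exists k.+1%:R^-1; first by rewrite invr_gt0.
  move=> t r /andP[_ tk] [x [Kx xM fx far]]; rewrite leNgt; apply/negP => eta_r.
  apply: nox; exists x; split=> //.
    by rewrite (le_trans fx) // lerD2l ltW.
  by move=> y Ky fy; rewrite (le_trans (ltW eta_r)) // far.
have [x hx] := choice step.
have [|v [sigma [sigma_ge xv]]] := @bounded_extraction _ _ x M.
  by move=> k; case: (hx k).
have Kv : K v.
  split=> [i|j].
    apply/eqP; rewrite eq_le; apply/andP; split.
      apply: (cvg_peval_le xv (cvg_cst (0 : R))) => k.
      by have [[-> _]] := hx (sigma k).
    rewrite -oppr_le0 -mevalN.
    apply: (cvg_peval_le (h := - p i) xv (cvg_cst (0 : R))) => k.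
    by rewrite /peval mevalN oppr_le0; have [[/(_ i)]] := hx (sigma k); rewrite /peval => ->.
  apply: (cvg_peval_le xv (cvg_cst (0 : R))) => k.
  by have [[_ ->]] := hx (sigma k).
have fv : peval f v <= w.
  rewrite -[w]addr0.
  apply: (cvg_peval_le xv (cvgD (cvg_cst w) (@cvg_harmonic R))) => k.
  have [_ _ fx _] := hx (sigma k); rewrite (le_trans fx) // lerD2l.
  by rewrite /harmonic lef_pV2 ?posrE ?ltr0n // ler_nat ltnS.
have : eta <= 0.
  apply: (ler_cvg_to (cvg_cst eta) (sqdist_cvg xv)); near=> k.
  by have [_ _ _ ->] := hx (sigma k).
by rewrite leNgt eta_gt0.
Unshelve. all: by end_near.
Qed.

(** This is a Hoelderian error bound (Lojasiewicz inequality) for the sublevel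
    set; stating it with an arbitrary [r] above the rate avoids nearest
    points. *)
Lemma sublevel_holder_bound (x0 : 'rV[R]_n) : K x0 -> `|x0| <= M ->
  peval f x0 <= w ->
  exists (k : nat) (C delta : R), [/\ 0 < C, 0 < delta &
    forall t x, 0 < t < delta -> K x -> `|x| <= M -> peval f x <= w + t ->
      forall r, 0 <= r -> C * t < r ^+ k.+1 ->
        exists y, [/\ K y, peval f y <= w & sqdist x y < r]].
Proof.
move=> Kx0 x0M fx0; have M_ge0 : 0 <= M by exact: le_trans x0M.
have gap0 (t : R) : 0 < t -> sublevel_gap t 0.
  move=> t0; exists x0; split=> //; first by rewrite (le_trans fx0) // lerDl ltW.
  by move=> y _ _; apply: sumr_ge0 => i _; exact: sqr_ge0.
have [k [C [delta [C0 d0 rate]]]] := definable_vanishing_rate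
  (definable_sublevel_gap M_ge0) gap0 sublevel_gap_vanishes.
exists k, C, delta; split=> // t x t0d Kx xM fx r r0 Ctr.
apply: contrapT => noy.
have : r ^+ k.+1 <= C * t.
  apply: rate => //; exists x; split=> // y Ky fy.
  by rewrite leNgt; apply/negP => lt; apply: noy; exists y.
by rewrite leNgt Ctr.
Qed.

End ErrorBound.

(** * Stability of the solution map *)

Lemma Sol_sublevel (R : realType) (n : nat) (S : set 'rV[R]_n)
    (f : mpoly n R) (x0 y : 'rV[R]_n) :
  Sol S f x0 -> S y -> peval f y <= peval f x0 -> Sol S f y.
Proof.
by move=> [_ x0min] Sy yx0; split=> // z /x0min; exact: le_trans.
Qed.

(** Compare [f x] with [g x], [g x] with [g x0], and [g x0] with [f x0]: the
    middle difference is nonpositive. *)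
Lemma Sol_perturbation_value (R : realType) (n : nat) (S : set 'rV[R]_n)
    (f g : mpoly n R) (x x0 : 'rV[R]_n) (b : R) :
  Sol S g x -> S x0 -> `|peval (g - f) x| <= b -> `|peval (g - f) x0| <= b ->
  peval f x <= peval f x0 + 2 * b.
Proof.
move=> [_ xmin] /xmin gx; rewrite !pevalB !ler_norml => /andP[bx _] /andP[_ bx0].
lra.
Qed.

Lemma enorm_scale_ball (R : realType) n (x y : 'rV[R]_n) (r : R) :
  0 < r -> sqdist x y < r ^+ 2 -> exists2 b, @eball R n b & x = y + r *: b.
Proof.
move=> r0 xy; exists (r^-1 *: (x - y)); last first.
  by rewrite scalerA divff ?gt_eqF // scale1r addrC subrK.
rewrite /eball /= /enorm -[leRHS]sqrtr1 ler_sqrt ?ler01 //.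
under eq_bigr do rewrite !mxE exprMn.
rewrite -mulr_sumr exprVn mulrC ler_pdivrMr ?exprn_gt0 // mul1r.
exact: ltW.
Qed.

Theorem theorem4p1 (R : realType) (n d : nat) (f : mpoly n R)
    (hd : (2 <= d)%N) (hf : pdeg f = d)
    (s m : nat) (p : 'I_s -> mpoly n R) (q : 'I_m -> mpoly n R)
    (K : set 'rV[R]_n)
    (hK : K = [set x | (forall i, peval (p i) x = 0) /\
                       (forall j, peval (q j) x <= 0)])
    (K_nonempty : K !=set0) (K_convex : convex_set K)
    (reg : regular K f)
    (Sol_nonempty : Sol K f !=set0) :
  exists l H eps : R,
    [/\ 0 < l, 0 < H, 0 < eps
      & forall g : mpoly n R, (pdeg g <= d)%N -> coef_norm (g - f) < eps ->
          Sol K g `<=`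
            [set y + (l * coef_norm (g - f) `^ H) *: b
               | y in Sol K f & b in @eball R n]].
Proof.
have [x0 Sx0] := Sol_nonempty; have [Kx0 x0min] := Sx0.
have d_gt0 : (0 < pdeg f)%N by rewrite hf ltnW.
have [M [eps0 [M_ge1 eps0_gt0 x0M bnd]]] := Sol_locally_bounded d_gt0 Sx0 reg.
have [N N_gt0 hN] := @peval_bound R n d.
have KE : basic_closed_set p q = K by rewrite hK.
have Kx0' : basic_closed_set p q x0 by rewrite KE.
have [k [C [delta [C_gt0 delta_gt0 error]]]] :=
  @sublevel_holder_bound R n f s m p q (peval f x0) M x0 Kx0' x0M (lexx _).
have M_gt0 : 0 < M by exact: lt_le_trans M_ge1.
pose A := 2 * (N * M ^+ d).
have A_gt0 : 0 < A by rewrite /A !mulr_gt0 ?exprn_gt0.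
(* The error bound controls the power [k.+1] of a squared distance, hence an
   exponent 1/(2(k+1)) for the distance; the factor 2 in front of [C] below
   provides the strict inequality that the error bound requires. *)
pose H : R := (2 * k.+1)%:R^-1.
have H_gt0 : 0 < H by rewrite invr_gt0 ltr0n.
exists ((2 * C * A) `^ H), H, (Num.min eps0 (delta / A)).
have CA_gt0 : 0 < 2 * C * A by rewrite mulr_gt0 // mulr_gt0.
split=> //.
- by rewrite powR_gt0.
- by rewrite lt_min eps0_gt0 divr_gt0.
move=> g gd; rewrite lt_min => /andP[gf_eps0 gf_delta] x Sgx; have [Kx _] := Sgx.
set e := coef_norm (g - f).
have xM : `|x| <= M by apply: bnd Sgx; rewrite ?hf.
have gfd : (pdeg (g - f)%R <= d)%N by rewrite pdeg_sub_le ?hf // ltnW.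
have fx : peval f x <= peval f x0 + A * e.
  have := Sol_perturbation_value Sgx Kx0 (hN _ _ _ gfd M_ge1 xM) (hN _ _ _ gfd M_ge1 x0M).
  by rewrite -/e [N * e * _]mulrAC mulrA.
(* The error bound needs a positive relaxation; without perturbation [x] is
   itself a minimizer of [f]. *)
have [e0|e_neq0] := eqVneq e 0.
  exists x; first by apply: (Sol_sublevel Sx0) => //; move: fx; rewrite e0 mulr0 addr0.
  exists 0; last by rewrite scaler0 addr0.
  by rewrite /eball /= /enorm big1 ?sqrtr0 // => i _; rewrite mxE expr0n.
have e_gt0 : 0 < e by rewrite lt_def e_neq0 /e coef_norm_ge0.
pose r := (2 * C * A) `^ H * e `^ H.
have r_gt0 : 0 < r by rewrite mulr_gt0 ?powR_gt0.
have r_pow : (r ^+ 2) ^+ k.+1 = 2 * C * A * e.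
  rewrite -exprM /r -powRM ?(ltW CA_gt0) ?(ltW e_gt0) //.
  rewrite -powR_mulrn ?powR_ge0 // -powRrM /H mulVf ?pnatr_eq0 // powRr1 //.
  by rewrite mulr_ge0 // ltW.
have [||||y [Ky fy xy]] := error (A * e) x _ _ xM fx (r ^+ 2) _ _.
- by rewrite mulr_gt0 //= mulrC -ltr_pdivlMr.
- by rewrite KE.
- exact: sqr_ge0.
- rewrite r_pow -(mulrA 2 C A) -(mulrA 2) -(mulrA C) ltr_pMl ?ltr1n //.
  by rewrite mulr_gt0 // mulr_gt0.
have [b bb xE] := enorm_scale_ball r_gt0 xy.
exists y; first by apply: (Sol_sublevel Sx0) => //; rewrite -KE.
by exists b.
Qed.
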